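(* A sequence $\mathbf{x}$ over a finite alphabet is eventually periodic if and only if both sequences $(r_{\mathbf{x}}(2n))_{n\ge 0}$ and $(r_{\mathbf{x}}(2n+1))_{n\ge 0}$ are eventually constant.
   Context: A factor of a sequence is a finite contiguous block. For a finite word $u=u(1)\cdots u(m)$, its reversal is $u^R=u(m)\cdots u(1)$; $u$ and $v$ are reflectively equivalent if $v=u$ or $v=u^R$. The reflection complexity $r_{\mathbf{x}}(n)$ is the number of distinct length-$n$ factors of $\mathbf{x}$ up to reflective equivalence. $\mathbf{x}$ is eventually periodic if $\mathbf{x}=uv^\omega$ for finite words $u,v$ with $v$ nonempty. *)

(* Defs.v *)
From mathcomp Require Import all_boot.
From mathcomp Require Import boolp.

Set Implicit Arguments.
Unset Strict Implicit.
Unset Printing Implicit Defensive.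

Section Words.
Variable A : finType.
Implicit Types (x y : nat -> A) (u v : seq A).

Definition block x (i n : nat) : n.-tuple A := [tuple x (i + j) | j < n].

(* Being a factor is not decidable from x; hence the classical truth value. *)
Definition factors x (n : nat) : {set n.-tuple A} :=
  [set w : n.-tuple A | `[< exists i, w = block x i n >] ].

Definition reflectively_equivalent (n : nat) : rel (n.-tuple A) :=
  fun w1 w2 => (w2 == w1) || (w2 == rev_tuple w1).

Lemma reflectively_equivalent_equiv n :
  equivalence_rel (@reflectively_equivalent n).
Proof.
have rev_tupleK (w : n.-tuple A) : rev_tuple (rev_tuple w) = w.
  by apply: val_inj; rewrite /= revK.
move=> w1 w2 w3; split; first by rewrite /reflectively_equivalent eqxx.
case/orP=> /eqP -> //; rewrite /reflectively_equivalent rev_tupleK.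
by rewrite orbC.
Qed.

(* The classes are taken inside the set of factors, which need not be closed
   under reversal. *)
Definition reflection_complexity x (n : nat) : nat :=
  #|equivalence_partition (@reflectively_equivalent n) (factors x n)|.

(* The periodic sequence v^omega, for the nonempty word v = a :: s. *)
Definition omega_power (a : A) (s : seq A) : nat -> A :=
  fun i => nth a (a :: s) (i %% size (a :: s)).

(* The concatenation u y; the default value of nth is used once i >= size u. *)
Definition prepend u y : nat -> A := fun i => nth (y (i - size u)) u i.

Definition eventually_periodic x : Prop :=
  exists (u : seq A) (a : A) (s : seq A), x =1 prepend u (omega_power a s).

End Words.

Definition eventually_constant (f : nat -> nat) : Prop :=
  exists c N : nat, forall n : nat, N <= n -> f n = c.

(* Main.v *)
(** The map sending a word to the pair {w, w^R} identifies at most two words, so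
    bounded reflection complexity forces bounded factor complexity, and hence two
    positions of x from which the same sequence is read.

    Conversely, if y is purely periodic, removing the first and the last letter
    sends the classes of length n+2 onto those of length n, so the complexity is
    nondecreasing along each parity, and it is bounded by the period.
    Putting one letter in front of a sequence y adds one class at length n
    exactly when the new prefix of length n is, up to reversal, not a factor
    of y; once this happens it persists for all larger n. *)

Require Import Defs.
From mathcomp Require Import all_boot.
From mathcomp Require Import boolp zify.

Set Implicit Arguments.
Unset Strict Implicit.
Unset Printing Implicit Defensive.

Lemma bounded_nondecreasing_eventually_constant (g : nat -> nat) (M : nat) :
  (forall n, g n <= g n.+1) -> (forall n, g n <= M) -> eventually_constant g.
Proof.
move=> g_mono g_le.
have g_homo : {homo g : m n / m <= n}.
  exact: (homo_leq leqnn leq_trans).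
have ex_val : exists m, `[< exists n, g n = m >].
  by exists (g 0); apply/asboolP; exists 0.
have val_le m : `[< exists n, g n = m >] -> m <= M.
  by move=> /asboolP [n <-].
case: (ex_maxnP ex_val val_le) => c /asboolP [N gN] c_max.
exists c, N => n le_Nn; apply/eqP; rewrite eqn_leq -{2}gN g_homo // andbT.
by apply: c_max; apply/asboolP; exists n.
Qed.

Lemma eventually_constantD (f g : nat -> nat) :
  eventually_constant f -> eventually_constant g ->
  eventually_constant (fun n => f n + g n).
Proof.
move=> [c [M fc]] [d [N gd]]; exists (c + d), (maxn M N) => n.
by rewrite geq_max => /andP [le_Mn le_Nn]; rewrite fc ?gd.
Qed.

Section ReflectionClasses.
Variable A : finType.
Implicit Types (x y : nat -> A) (n p : nat).

(** * Counting classes by pairs {w, w^R} *)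

Definition reflection_class n (w : n.-tuple A) : {set n.-tuple A} :=
  [set w; rev_tuple w].

Lemma rev_tupleK n : involutive (@rev_tuple n A).
Proof. by move=> w; apply: val_inj; rewrite /= revK. Qed.

Lemma mem_reflection_class n (w w' : n.-tuple A) :
  (w' \in reflection_class w) = (reflection_class w' == reflection_class w).
Proof.
apply/idP/eqP => [|<-]; last by rewrite !inE eqxx.
by rewrite !inE /reflection_class => /orP [] /eqP -> //; rewrite rev_tupleK setUC.
Qed.

Lemma factorsP x n (w : n.-tuple A) :
  reflect (exists i, w = block x i n) (w \in factors x n).
Proof. by rewrite inE; apply: asboolP. Qed.

Lemma block_factors x i n : block x i n \in factors x n.
Proof. by apply/factorsP; exists i. Qed.

Lemma nth_block a x i n k : k < n -> nth a (block x i n) k = x (i + k).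
Proof. by move=> lt_kn; rewrite -[k]/(val (Ordinal lt_kn)) -tnth_nth tnth_mktuple. Qed.

Lemma nth_rev_block a x i n k :
  k < n -> nth a (rev_tuple (block x i n)) k = x (i + (n - k.+1)).
Proof.
move=> lt_kn; rewrite nth_rev size_tuple // nth_block //; lia.
Qed.

(** The blocks of the partition are the traces on [D] of the full pairs {w, w^R}. Taking traces is
    injective on these pairs, because a trace keeps its word [w] of [D] and any member determines
    its pair. Full pairs do not depend on the sequence, so they can be compared between a sequence
    and its tail. *)
Lemma reflection_complexity_imset x n :
  reflection_complexity x n = #|@reflection_class n @: factors x n|.
Proof.
pose D := factors x n.
have -> : reflection_complexity x n
    = #|(fun B => D :&: B) @: (@reflection_class n @: D)|.
  rewrite -imset_comp /reflection_complexity; congr #|pred_of_set _|.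
  apply: eq_imset => w /=; apply/setP => w'.
  by rewrite !inE /reflectively_equivalent.
apply: card_in_imset => _ _ /imsetP [w Dw ->] /imsetP [w' _ ->] /setP /(_ w).
by rewrite !in_setI Dw !mem_reflection_class eqxx => /esym /eqP.
Qed.

Lemma card_factors_le x n : #|factors x n| <= 2 * reflection_complexity x n.
Proof.
rewrite reflection_complexity_imset.
set P := _ @: _.
have sub_cover : factors x n \subset cover P.
  apply/subsetP => w Fw; apply/bigcupP; exists (reflection_class w).
    exact: imset_f.
  by rewrite mem_reflection_class.
apply: leq_trans (subset_leq_card sub_cover) _.
apply: leq_trans (leq_card_cover P).1 _.
rewrite mulnC -sum_nat_const; apply: leq_sum => _ /imsetP [w _ ->].
by rewrite cards2; case: (_ != _).
Qed.

(** * Purely periodic sequences *)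

Lemma periodic_reflection_complexity_le x p n :
  0 < p -> (forall i, x (i + p) = x i) -> reflection_complexity x n <= p.
Proof.
move=> p_gt0 xp; rewrite reflection_complexity_imset.
apply: leq_trans (leq_imset_card _ _) _.
have xM i m : x (i + m * p) = x i.
  by elim: m => [|m IHm]; rewrite ?addn0 // mulSn (addnC p) addnA xp.
have sub : factors x n \subset [set block x i n | i : 'I_p].
  apply/subsetP => _ /factorsP [i ->]; apply/imsetP.
  exists (Ordinal (ltn_pmod i p_gt0)) => //; apply: eq_from_tnth => k.
  rewrite !tnth_mktuple /= {1}(divn_eq i p) -addnA addnC; exact: xM.
apply: leq_trans (subset_leq_card sub) _.
by apply: leq_trans (leq_imset_card _ _) _; rewrite card_ord.
Qed.

(** The nested ordinal is the index [k.+1]. *)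
Definition center n (w : n.+2.-tuple A) : n.-tuple A :=
  [tuple tnth w (lift ord0 (widen_ord (leqnSn n) k)) | k < n].

Lemma center_block x i n : center (block x i n.+2) = block x i.+1 n.
Proof.
apply: eq_from_tnth => k; rewrite !tnth_mktuple /= /bump /=.
by congr x; lia.
Qed.

Lemma tnth_rev n (w : n.-tuple A) k : tnth (rev_tuple w) k = tnth w (rev_ord k).
Proof.
set a := tnth w k; rewrite (tnth_nth a) [RHS](tnth_nth a).
rewrite nth_rev size_tuple; [reflexivity | exact: ltn_ord].
Qed.

Lemma center_rev n (w : n.+2.-tuple A) :
  center (rev_tuple w) = rev_tuple (center w).
Proof.
apply: eq_from_tnth => k; rewrite tnth_rev !tnth_mktuple tnth_rev.
by congr tnth; apply: val_inj; rewrite /= /bump; have := ltn_ord k; lia.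
Qed.

Lemma center_reflection_class n (w : n.+2.-tuple A) :
  @center n @: reflection_class w = reflection_class (center w).
Proof. by rewrite imsetU !imset_set1 center_rev. Qed.

Lemma periodic_reflection_complexity_nondecreasing x p n :
  0 < p -> (forall i, x (i + p) = x i) ->
  reflection_complexity x n <= reflection_complexity x n.+2.
Proof.
move=> p_gt0 xp; rewrite !reflection_complexity_imset.
set P := @reflection_class n.+2 @: _.
apply: (leq_trans _ (leq_imset_card (fun B : {set n.+2.-tuple A} => @center n @: B) P)).
apply: subset_leq_card; apply/subsetP => _ /imsetP [_ /factorsP [i ->] ->].
(* Modulo the period, [i + p.-1] is the position just before [i]; this choice also works for
   [i = 0]. *)
apply/imsetP; exists (reflection_class (block x (i + p.-1) n.+2)).
  by rewrite imset_f ?block_factors.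
rewrite center_reflection_class center_block; congr reflection_class.
apply: eq_from_tnth => k; rewrite !tnth_mktuple -xp.
by congr x; lia.
Qed.

Definition reflection_complexity_eventually_constant x : Prop :=
  eventually_constant (fun n => reflection_complexity x (2 * n)) /\
  eventually_constant (fun n => reflection_complexity x (2 * n + 1)).

Lemma periodic_reflection_complexity_eventually_constant x p :
  0 < p -> (forall i, x (i + p) = x i) ->
  reflection_complexity_eventually_constant x.
Proof.
move=> p_gt0 xp.
split; apply: (@bounded_nondecreasing_eventually_constant _ p) => n;
  try exact: periodic_reflection_complexity_le.
- by rewrite mulnS add2n; apply: periodic_reflection_complexity_nondecreasing xp.
- by rewrite mulnS -addnA add2n; apply: periodic_reflection_complexity_nondecreasing xp.
Qed.

(** * Putting one letter in front *)

Definition prefix_avoids x n : bool :=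
  reflection_class (block x 0 n)
    \notin @reflection_class n @: factors (fun i => x i.+1) n.

Lemma reflection_complexity_tail x n :
  reflection_complexity x n =
    prefix_avoids x n + reflection_complexity (fun i => x i.+1) n.
Proof.
rewrite !reflection_complexity_imset -cardsU1 -imset_set1 -imsetU.
suff -> : factors x n = block x 0 n |: factors (fun i => x i.+1) n by [].
apply/setP => w; rewrite !inE; apply/asboolP/orP => [[[|i] ->]|].
- by left.
- by right; apply/asboolP; exists i; apply: eq_from_tnth => k; rewrite !tnth_mktuple.
case=> [/eqP ->|/asboolP [i ->]]; first by exists 0.
by exists i.+1; apply: eq_from_tnth => k; rewrite !tnth_mktuple.
Qed.

(** By contraposition: an occurrence in the tail of the longer prefix, or of its reversal, contains
    one of the shorter prefix or of its reversal. *)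
Lemma prefix_avoidsS x n : prefix_avoids x n -> prefix_avoids x n.+1.
Proof.
set y := fun i => x i.+1.
apply: contra => /imsetP [_ /factorsP [i ->] /eqP].
rewrite -mem_reflection_class in_set2 => /orP [] /eqP eq_pre; apply/imsetP.
  exists (block y i n); first exact: block_factors.
  congr reflection_class; apply: eq_from_tnth => k; rewrite !tnth_mktuple.
  have lt_kn : k < n.+1 by exact: ltnW (ltn_ord k).
  by rewrite -(nth_block (x 0) x 0 lt_kn) eq_pre nth_block.
(* In a reversed occurrence the extra letter of the prefix comes first, so the shorter one starts at
   [i.+1]. *)
exists (block y i.+1 n); first exact: block_factors.
apply/eqP; rewrite -mem_reflection_class in_set2; apply/orP; right; apply/eqP.
apply: eq_from_tnth => k; rewrite tnth_mktuple (tnth_nth (x 0)).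
have lt_kn := ltn_ord k; have lt_kn1 : k < n.+1 by exact: ltnW lt_kn.
rewrite nth_rev_block // -(nth_block (x 0) x 0 lt_kn1) eq_pre nth_rev_block //.
by rewrite /y; congr x; lia.
Qed.

Lemma tail_reflection_complexity_eventually_constant x :
  reflection_complexity_eventually_constant (fun i => x i.+1) ->
  reflection_complexity_eventually_constant x.
Proof.
have avoids_mono : {homo (fun n => prefix_avoids x n : nat) : m n / m <= n}.
  apply: (homo_leq leqnn leq_trans) => k.
  by have := @prefix_avoidsS x k; case: prefix_avoids => // ->.
rewrite /reflection_complexity_eventually_constant => -[even_c odd_c].
split; under eq_fun do rewrite reflection_complexity_tail;
  apply: eventually_constantD => //;
  apply: (@bounded_nondecreasing_eventually_constant _ 1) => n;
  try exact: leq_b1; apply: avoids_mono; lia.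
Qed.

Lemma eventually_periodic_reflection_complexity x :
  eventually_periodic x -> reflection_complexity_eventually_constant x.
Proof.
move=> [u [a [s /funext ->]]].
elim: u => [|b u IHu].
  apply: (@periodic_reflection_complexity_eventually_constant _ (size s).+1) => // i.
  by rewrite /prepend /omega_power /= !nth_nil !subn0 modnDr.
(* The tail of [prepend (b :: u) y] is [prepend u y] by conversion. *)
exact: tail_reflection_complexity_eventually_constant.
Qed.

(** * From few factors to eventual periodicity *)

Lemma repeated_tail_eventually_periodic x i j :
  i < j -> (forall k, x (i + k) = x (j + k)) -> eventually_periodic x.
Proof.
move=> lt_ij eq_tail; pose p := (j - i).-1.
have xp k m : x (i + (k + m * p.+1)) = x (i + k).
  elim: m => [|m IHm]; first by rewrite addn0.
  rewrite -IHm [in RHS]eq_tail; congr x; rewrite /p; lia.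
(* The period word is [x i] followed by [p] more letters, of total length [p.+1 = j - i]. *)
exists (mkseq x i), (x i), (mkseq (fun k => x (i + k.+1)) p) => k.
rewrite /prepend /omega_power size_mkseq.
case: (ltnP k i) => [lt_ki|le_ik]; first by rewrite nth_mkseq.
rewrite nth_default ?size_mkseq //= size_mkseq.
have -> : x k = x (i + (k - i) %% p.+1).
  by rewrite -(xp _ ((k - i) %/ p.+1)) [_ %% _ + _]addnC -divn_eq subnKC.
have := ltn_pmod (k - i) (ltn0Sn p).
by case: (_ %% _) => [|r] lt_rp /=; rewrite ?addn0 // nth_mkseq.
Qed.

(** Otherwise the tails from positions 0 to [M] are pairwise distinct. Once [n] exceeds an offset
    separating each pair, the [M.+1] blocks of length [n] at these positions are distinct factors,
    which is too many. *)
Lemma frequently_few_factors_eventually_periodic x M :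
  (forall N, exists2 n, N <= n & #|factors x n| <= M) -> eventually_periodic x.
Proof.
move=> few; apply: contrapT => aper.
(* The condition on the pair stays under the existential, so that [choice] gives an offset for every
   pair, diagonal ones included. *)
have sep (ij : 'I_M.+1 * 'I_M.+1) :
    exists k, ij.1 != ij.2 -> x (ij.1 + k) != x (ij.2 + k).
  case: ij => i j /=; apply: contrapT => no_sep; apply: aper.
  have eq_tail k : i != j /\ x (i + k) = x (j + k).
    have /not_implyP [-> /negP] := fun h => no_sep (ex_intro _ k h).
    by rewrite negbK => /eqP.
  have [ne_ij _] := eq_tail 0.
  case: (ltngtP i j) => [lt_ij|lt_ji|/val_inj eq_ij].
  - by apply: (repeated_tail_eventually_periodic lt_ij) => k; case: (eq_tail k).
  - by apply: (repeated_tail_eventually_periodic lt_ji) => k; case: (eq_tail k).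
  - by rewrite eq_ij eqxx in ne_ij.
have [K KP] := choice sep.
have [n lt_Kn] := few (\max_ij K ij).+1.
rewrite leqNgt => /negP; apply.
have block_inj : injective (fun i : 'I_M.+1 => block x i n).
  move=> i j eq_ij; apply/eqP; apply: contraT => ne_ij.
  have lt_k : K (i, j) < n by apply: leq_ltn_trans (leq_bigmax _) lt_Kn.
  have /negP [] := KP (i, j) ne_ij; apply/eqP => /=.
  by rewrite -!(nth_block (x 0) _ _ lt_k) eq_ij.
rewrite -[M.+1]card_ord -(card_imset _ block_inj) subset_leq_card //.
by apply/subsetP => _ /imsetP [i _ ->]; apply: block_factors.
Qed.

End ReflectionClasses.

Theorem theorem5p1 (A : finType) (x : nat -> A) :
  eventually_periodic x <->
  eventually_constant (fun n => reflection_complexity x (2 * n)) /\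
  eventually_constant (fun n => reflection_complexity x (2 * n + 1)).
Proof.
split; first exact: eventually_periodic_reflection_complexity.
move=> [[c [N even_c]] _].
apply: (@frequently_few_factors_eventually_periodic _ _ (2 * c)) => m.
(* Half the length must reach [N] for the complexity to be [c]; each class then holds at most two
   factors. *)
exists (2 * maxn m N); first by lia.
by rewrite -(even_c (maxn m N)) ?leq_maxr // card_factors_le.
Qed.
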